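(* Let $n=2k$, let $\tau$ be an integer with $1\le\tau\le k$, and let $r$ be an integer with $1<r<k$ and $\gcd(r,k)=1$. Let $\{u_1,\ldots,u_k\}$ be a basis of $\mathbb{F}_{2^k}$ over $\mathbb{F}_2$ and $G(x)=\sum_{i=1}^{2^r-1}x^{(i2^{k-r}+1)(2^k-1)+1}$ (an $(n,k)$-function). Let $F(X_1,\ldots,X_\tau)$ be a reduced polynomial in $\mathbb{F}_2[X_1,\ldots,X_\tau]$ of algebraic degree $d$ and $\{i_1,\ldots,i_\tau\}\subseteq\{1,\ldots,k\}$. Then $H(x)=G(x)+F(\mathrm{Tr}^n_1(u_{i_1}x),\ldots,\mathrm{Tr}^n_1(u_{i_\tau}x))$ is a vectorial bent $(n,k)$-function. Furthermore, if $d=k$ and the algebraic degree of $G$ is not equal to $k$, then $H$ has algebraic degree $k$.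
   Context: $\mathrm{Tr}^m_1(x)=\sum_{i=0}^{m-1}x^{2^i}$. An $(n,k)$-function $H$ is vectorial bent if $\mathrm{Tr}^k_1(\lambda H(x))$ is a bent Boolean function for every $\lambda\in\mathbb{F}_{2^k}^*$ (bent: $|\sum_x(-1)^{f(x)+\mathrm{Tr}^n_1(ax)}|=2^{n/2}$ for all $a$). A reduced polynomial is a multilinear polynomial $\sum_I a_I\prod_{i\in I}X_i$ over $\mathbb{F}_2$, with algebraic degree the largest $|I|$ with $a_I\ne0$. The algebraic degree of a vectorial function is the maximal algebraic degree of its coordinate Boolean functions. *)

(* Defs.v *)
From HB Require Import structures.
From mathcomp Require Import all_boot all_order all_algebra all_field.
Set Implicit Arguments. Unset Strict Implicit. Unset Printing Implicit Defensive.
Import Order.TTheory GRing.Theory Num.Theory.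
Local Open Scope ring_scope.

Section Defs.
Variable L : finFieldType.

Definition trace (m : nat) (y : L) : L := \sum_(i < m) y ^+ (2 ^ i).

Definition subK (k : nat) : pred L := fun y => y ^+ (2 ^ k) == y.

Definition f2indep (m : nat) (v : 'I_m -> L) : Prop :=
  forall b : 'I_m -> bool, \sum_(i < m | b i) v i = 0 -> forall i, ~~ b i.

(* (-1)^y for y in F_2 = {0,1} inside L *)
Definition sgn (y : L) : int := if y == 0 then 1%R else (-1)%R.

(* bent Boolean function (values 0/1 in L) on F_{2^n} = L *)
Definition bent (n : nat) (f : L -> L) : Prop :=
  forall a : L, `| \sum_(x : L) sgn (f x + trace n (a * x)) | = (2 ^ (n./2))%:Z.

Definition vbent (n k : nat) (H : L -> L) : Prop :=
  (forall x, subK k (H x)) /\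
  forall lam : L, subK k lam -> lam != 0 -> bent n (fun x => trace k (lam * H x)).

(* reduced polynomial over F_2 in t variables: coefficient a_I for I ⊆ {1..t} *)
Definition eval_red (t : nat) (a : {ffun {set 'I_t} -> bool}) (X : 'I_t -> L) : L :=
  \sum_(I : {set 'I_t} | a I) \prod_(i in I) X i.

Definition deg_red (t : nat) (a : {ffun {set 'I_t} -> bool}) : nat :=
  \max_(I : {set 'I_t} | a I) #|I|.

(* ANF coefficient and algebraic degree of a Boolean function g : L -> F_2,
   w.r.t. an F_2-basis e of L (coordinates x = sum_{j in J} e_j) *)
Definition anf_coef (n : nat) (e : 'I_n -> L) (g : L -> bool) (I : {set 'I_n}) : bool :=
  odd #|[set J in powerset I | g (\sum_(j in J) e j)]|.

Definition bool_deg (n : nat) (e : 'I_n -> L) (g : L -> bool) : nat :=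
  \max_(I : {set 'I_n} | anf_coef e g I) #|I|.

Definition coords (k : nat) (w : 'I_k -> L) (y : L) : {ffun 'I_k -> bool} :=
  odflt [ffun=> false]
    [pick b : {ffun 'I_k -> bool} | y == \sum_(i < k) (b i)%:R * w i].

Definition vec_deg (n k : nat) (e : 'I_n -> L) (w : 'I_k -> L) (H : L -> L) : nat :=
  \max_(j < k) bool_deg e (fun x => coords w (H x) j).

Definition Gfun (k r : nat) (x : L) : L :=
  \sum_(1 <= i < 2 ^ r) x ^+ ((i * 2 ^ (k - r) + 1) * (2 ^ k - 1) + 1).

Definition Hfun (n k r t : nat) (u : 'I_k -> L) (a : {ffun {set 'I_t} -> bool})
  (idx : 'I_t -> 'I_k) (x : L) : L :=
  Gfun k r x + eval_red a (fun j => trace n (u (idx j) * x)).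

End Defs.

(* Main.v *)
(** Let [K] be the subfield [F_(2^k)] and [sigma := 2 ^ (k - r)].  Summing the
    geometric progression shows that, with [y := x + x ^+ (2 ^ k)],
    [G x = y * (x / y) ^+ sigma + x + y].  The perturbation [F] only depends on
    [y], because [u i] is in [K].  So on each coset [x + K] (on which [y] is
    constant) [H] is additive up to a constant, and the Walsh summand is a
    constant times the character
    [s |-> Tr ((lam^(2^r) y^(2^r-1) + lam + a + a^(2^k)) s)] of [K].  As
    [gcd (r, k) = 1], [y |-> y^(2^r-1)] (with [0 |-> 0]) permutes [K], so exactly
    one coset contributes to the Walsh sum, and it contributes [+- 2^k].

    For the degree, the coefficients at [I] of the coordinates of [H] are the
    coordinates of the sum of [H] over the subset sums of [(e i)_(i in I)].  For
    [#|I| > k] it vanishes because [H] and [G] are vectorial bent (Rothaus' bound).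
    For a set [I] of [k] indices on which the [k] functionals [Tr (u i x)] separate
    subset sums, that of [F] is the sum of [F] over the cube, i.e. its top
    coefficient, while that of [G] is zero when [G] has degree less than [k]. *)
Require Import Defs.
From HB Require Import structures.
From mathcomp Require Import all_boot all_order all_algebra all_field.
From mathcomp Require Import ring zify.
Set Implicit Arguments. Unset Strict Implicit. Unset Printing Implicit Defensive.
Import Order.TTheory GRing.Theory Num.Theory.
Local Open Scope ring_scope.

(** * Frobenius, subfields, absolute traces and signs in characteristic 2 *)

Section Char2.
Variables (L : finFieldType) (char2 : 2 \in [pchar L]).
Implicit Types (x y z : L) (m i : nat).

Lemma frobD i x y : (x + y) ^+ (2 ^ i) = x ^+ (2 ^ i) + y ^+ (2 ^ i).
Proof. by apply: exprDn_pchar; rewrite pnatX pnatE ?char2. Qed.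

Lemma frob0 i : (0 : L) ^+ (2 ^ i) = 0.
Proof. by rewrite expr0n expn_eq0. Qed.

Lemma frob_sum i (I : Type) (s : seq I) (P : pred I) (F : I -> L) :
  (\sum_(j <- s | P j) F j) ^+ (2 ^ i) = \sum_(j <- s | P j) F j ^+ (2 ^ i).
Proof. by apply: (big_morph _ (frobD i) (frob0 i)). Qed.

Lemma frob_comp i j x : (x ^+ (2 ^ i)) ^+ (2 ^ j) = x ^+ (2 ^ (i + j)).
Proof. by rewrite -exprM expnD. Qed.

Lemma subKE m x : subK m x -> x ^+ (2 ^ m) = x.
Proof. by move/eqP. Qed.

Lemma subK_0 m : subK m (0 : L). Proof. by rewrite /subK frob0. Qed.
Lemma subK_1 m : subK m (1 : L). Proof. by rewrite /subK expr1n. Qed.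

Lemma subKD m x y : subK m x -> subK m y -> subK m (x + y).
Proof. by move=> /eqP hx /eqP hy; rewrite /subK frobD hx hy. Qed.

Lemma subKM m x y : subK m x -> subK m y -> subK m (x * y).
Proof. by move=> /eqP hx /eqP hy; rewrite /subK exprMn hx hy. Qed.

Lemma subKV m x : subK m x -> subK m x^-1.
Proof. by move=> /eqP hx; rewrite /subK exprVn hx. Qed.

Lemma subKX m i x : subK m x -> subK m (x ^+ i).
Proof. by move=> /eqP hx; rewrite /subK exprAC hx. Qed.

Lemma subK_sum m (I : Type) (s : seq I) (P : pred I) (F : I -> L) :
  (forall j, P j -> subK m (F j)) -> subK m (\sum_(j <- s | P j) F j).
Proof. by move=> h; elim/big_ind: _ => //; [apply: subK_0 | apply: subKD]. Qed.

Lemma subK_prod m (I : Type) (s : seq I) (P : pred I) (F : I -> L) :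
  (forall j, P j -> subK m (F j)) -> subK m (\prod_(j <- s | P j) F j).
Proof. by move=> h; elim/big_ind: _ => //; [apply: subK_1 | apply: subKM]. Qed.

Lemma subK_iter m i x : subK m x -> x ^+ (2 ^ (m * i)) = x.
Proof.
move=> /eqP hx; elim: i => [|i IH]; first by rewrite muln0 expr1.
by rewrite mulnS expnD exprM hx.
Qed.

(* [subK 1] is the prime field. *)
Lemma bitP x : subK 1 x -> x = (x != 0)%:R.
Proof.
rewrite /subK expn1 expr2 => /eqP hx; case: eqVneq => [-> // | nz].
by apply: (mulfI nz); rewrite mulr1.
Qed.

Lemma subK_bit m x : subK 1 x -> subK m x.
Proof. by move/bitP ->; case: (x != 0) => /=; rewrite ?subK_1 ?subK_0. Qed.

Lemma addbR (b c : bool) : (b (+) c)%:R = b%:R + c%:R :> L.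
Proof. by case: b; case: c; rewrite ?addr0 ?add0r //= addrr_pchar2. Qed.

Lemma bit_neq0D x y :
  subK 1 x -> subK 1 y -> (x + y != 0) = (x != 0) (+) (y != 0).
Proof.
move=> /bitP-> /bitP->; rewrite -addbR.
by case: (x != 0); case: (y != 0); rewrite /= ?oner_eq0 ?eqxx.
Qed.

Lemma natr_odd m : m%:R = (odd m)%:R :> L.
Proof. by rewrite -(GRing.natr_mod_pchar char2) modn2. Qed.

Lemma sgnE x : sgn x = (-1) ^+ (x != 0).
Proof. by rewrite /sgn; case: eqP. Qed.

Lemma sgnD x y : subK 1 x -> subK 1 y -> sgn (x + y) = sgn x * sgn y.
Proof. by move=> hx hy; rewrite !sgnE bit_neq0D // signr_addb. Qed.

Lemma sgn0 : sgn (0 : L) = 1. Proof. by rewrite /sgn eqxx. Qed.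

Lemma traceD m x y : trace m (x + y) = trace m x + trace m y.
Proof. by rewrite -big_split; apply: eq_bigr => i _; rewrite frobD. Qed.

Lemma trace0 m : trace m (0 : L) = 0.
Proof. by rewrite /trace big1 // => i _; rewrite frob0. Qed.

Lemma trace_sum m (I : Type) (s : seq I) (P : pred I) (F : I -> L) :
  trace m (\sum_(j <- s | P j) F j) = \sum_(j <- s | P j) trace m (F j).
Proof. by apply: (big_morph _ (traceD m) (trace0 m)). Qed.

Lemma trace_add m i x : trace (m + i) x = trace m x + trace i (x ^+ (2 ^ m)).
Proof.
rewrite /trace big_split_ord; congr (_ + _).
by apply: eq_bigr => j _; rewrite frob_comp.
Qed.

(** Splitting [trace (1 + m) x] after the first term or before the last one isolates the same
    summand [x], which cancels. *)
Lemma trace_sqr m x : subK m x -> trace m (x ^+ 2) = trace m x.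
Proof.
move=> /eqP hx; have h1 := trace_add 1 m x; have h2 := trace_add m 1 x.
move: h1; rewrite addnC h2 hx expn1 [trace m x + _]addrC => /addrI h.
by rewrite -h.
Qed.

Lemma trace_frob m i x : subK m x -> trace m (x ^+ (2 ^ i)) = trace m x.
Proof.
move=> hx; elim: i => [|i IH]; first by rewrite expr1.
by rewrite expnS mulnC exprM trace_sqr ?subKX.
Qed.

Lemma trace_bit m x : subK m x -> subK 1 (trace m x).
Proof.
move=> hx; rewrite /subK frob_sum expn1 -[eqbRHS]trace_sqr //.
by apply/eqP/eq_bigr => i _; rewrite exprAC.
Qed.

(** As a polynomial the trace has degree [2 ^ (m - 1)], too small to have [2 ^ m] roots. *)
Lemma trace_neq0 m : (0 < m)%N -> #|[pred x : L | subK m x]| = (2 ^ m)%N ->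
  exists2 s : L, subK m s & trace m s != 0.
Proof.
case: m => // m _ hcard; apply/exists_inP; apply: contraT => /exists_inPn h0.
pose p : {poly L} := \sum_(i < m.+1) 'X^(2 ^ i).
have sp : size p = (2 ^ m).+1.
  rewrite /p big_ord_recr /= addrC size_polyDl ?size_polyXn // ltnS.
  apply: (leq_trans (size_sum _ _ _)); apply/bigmax_leqP => i _.
  by rewrite size_polyXn ltn_exp2l.
have pnz : p != 0 by rewrite -size_poly_gt0 sp.
have := max_poly_roots pnz (rs := enum [pred x : L | subK m.+1 x]).
rewrite enum_uniq -cardE hcard sp ltnS leq_exp2l // ltnn => -> //.
apply/allP => x; rewrite mem_enum inE => hx; rewrite rootE.
have := h0 x hx; rewrite negbK /trace /p horner_sum => /eqP h; apply/eqP.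
by rewrite -[RHS]h; apply: eq_bigr => i _; rewrite hornerXn.
Qed.

(** Orthogonality of characters: for [b != 0], translating by [s0 / b] with [trace m s0 != 0] flips
    every sign, so the sum equals its opposite. *)
Lemma sum_sgn_trace m b : (0 < m)%N -> #|[pred x : L | subK m x]| = (2 ^ m)%N ->
  subK m b ->
  \sum_(s : L | subK m s) sgn (trace m (b * s)) = (2 ^ m * (b == 0))%:Z.
Proof.
move=> m0 hcard hb; case: eqVneq => [->|nz].
  rewrite (eq_bigr (fun=> 1)) => [|s _]; last by rewrite mul0r trace0 sgn0.
  by rewrite sumr_const muln1 -natz; congr (_%:R); rewrite -[RHS]hcard.
have [s0 hs0 ts0] := trace_neq0 m0 hcard.
have nz2 : (2 : int) != 0 by [].
rewrite muln0; apply: (mulfI nz2); rewrite mulr0 mulr2n mulrDl !mul1r.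
have hv : subK m (s0 / b) by rewrite subKM // subKV.
rewrite {1}(reindex_inj (addrI (s0 / b))) /=.
rewrite -[RHS](addNr (\sum_(s | subK m s) sgn (trace m (b * s)))).
congr (_ + _); rewrite -sumrN.
have hE s : subK m (s0 / b + s) = subK m s.
  apply/idP/idP => h; last exact: subKD.
  by rewrite -(addKr_pchar2 char2 (s0 / b) s) subKD.
rewrite (eq_bigl _ _ hE); apply: eq_bigr => s hs.
rewrite mulrDr mulrCA divff // mulr1 traceD sgnD ?trace_bit ?subKM //.
by rewrite {1}/sgn (negPf ts0) mulN1r.
Qed.

End Char2.

(** * The relative trace from [L] to [K], and the closed form of [G] *)

Section QuadraticExtension.
Variables (L : finFieldType) (k : nat).
Hypotheses (k_gt0 : (0 < k)%N) (hL : #|L| = (2 ^ k.*2)%N).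
Implicit Types (x y s c a lam : L) (r : nat).

Let char2 : 2 \in [pchar L] := card_finPcharP hL isT.

Definition reltrace x := x + x ^+ (2 ^ k).

Lemma frob_involutive x : (x ^+ (2 ^ k)) ^+ (2 ^ k) = x.
Proof. by rewrite frob_comp addnn -hL expf_card. Qed.

Lemma subK_reltrace x : subK k (reltrace x).
Proof. by rewrite /subK /reltrace frobD // frob_involutive addrC. Qed.

Lemma reltrace_addK x s : subK k s -> reltrace (x + s) = reltrace x.
Proof.
move=> /subKE hs; rewrite /reltrace frobD // hs addrACA.
by rewrite (addrr_pchar2 char2 s) addr0.
Qed.

Lemma reltrace_eq0 x : (reltrace x == 0) = subK k x.
Proof. by rewrite /reltrace addr_eq0 (oppr_pchar2 char2) eq_sym. Qed.

Lemma reltraceD x y : reltrace (x + y) = reltrace x + reltrace y.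
Proof. by rewrite /reltrace frobD // addrACA. Qed.

(** [K] consists of roots of ['X^(2 ^ k) - 'X], so it has at most [2 ^ k] elements. A fibre of
    [reltrace] is empty or a coset of [K], whence [#|L| <= #|K| ^ 2]. Both bounds must be
    equalities, and an empty fibre would break the second. *)
Lemma card_subK_reltrace_onto :
  #|[pred x : L | subK k x]| = (2 ^ k)%N /\
  forall y, subK k y -> exists x, reltrace x = y.
Proof.
pose K := [set x : L | subK k x]; pose F y := [set x : L | reltrace x == y].
have KE : #|[pred x : L | subK k x]| = #|K| by apply: eq_card => x; rewrite !inE.
have q1 : (1 < 2 ^ k)%N by rewrite -{1}(expn0 2) ltn_exp2l.
have leK : (#|K| <= 2 ^ k)%N.
  pose p : {poly L} := 'X^(2 ^ k) - 'X.
  have sp : size p = (2 ^ k).+1.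
    by rewrite /p size_polyDl ?size_polyN size_polyXn // size_polyX.
  have pnz : p != 0 by rewrite -size_poly_gt0 sp.
  have := max_poly_roots pnz (rs := enum K); rewrite -cardE enum_uniq sp ltnS; apply=> //.
  apply/allP => x; rewrite mem_enum inE => /subKE hx.
  by rewrite rootE !hornerE hx subrr.
have hsum : #|L| = (\sum_(y in K) #|F y|)%N.
  rewrite -sum1_card (partition_big reltrace (mem K)) /= => [|x _].
    by apply: eq_bigr => y _; rewrite -sum1_card; apply: eq_bigl => x; rewrite inE.
  by rewrite inE subK_reltrace.
have fib y : (#|F y| <= #|K|)%N.
  have [-> | [x0]] := set_0Vmem (F y); first by rewrite cards0.
  rewrite inE => /eqP hx0; apply: leq_trans (leq_imset_card (+%R x0) _).
  apply: subset_leq_card; apply/subsetP => x; rewrite inE => /eqP hx.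
  apply/imsetP; exists (x0 + x); last by rewrite (addKr_pchar2 char2).
  by rewrite inE -reltrace_eq0 reltraceD hx hx0 (addrr_pchar2 char2).
have cardK : #|K| = (2 ^ k)%N.
  apply/eqP; rewrite eqn_leq leK /= -leq_sqr -expnM muln2 -hL hsum.
  by rewrite -mulnn -sum_nat_const leq_sum.
split=> [|y hy]; first by rewrite KE.
have [F0 | [x]] := set_0Vmem (F y); last by rewrite inE => /eqP; exists x.
have yK : y \in K by rewrite inE.
have : (#|L| <= \sum_(z in K | z != y) #|K|)%N.
  by rewrite hsum (bigD1 y) //= F0 cards0 add0n leq_sum.
rewrite -(leq_add2l #|K|) -(bigD1 (F := fun=> #|K|) y yK) /= sum_nat_const mulnn.
rewrite hL cardK -expnM muln2 -{2}[(2 ^ k.*2)%N]add0n leq_add2r leqn0 => /eqP h.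
by rewrite h in q1.
Qed.

Lemma card_subK : #|[pred x : L | subK k x]| = (2 ^ k)%N.
Proof. by case: card_subK_reltrace_onto. Qed.

Lemma reltrace_onto y : subK k y -> exists x, reltrace x = y.
Proof. by case: card_subK_reltrace_onto => _; apply. Qed.

Lemma trace_double x : trace k.*2 x = trace k (reltrace x).
Proof. by rewrite -addnn trace_add traceD. Qed.

Lemma subK_full x : subK k.*2 x.
Proof. by rewrite /subK -hL expf_card. Qed.

Lemma card_subK_full : #|[pred x : L | subK k.*2 x]| = (2 ^ k.*2)%N.
Proof. by rewrite -hL; apply: eq_card => x; rewrite !inE subK_full. Qed.

(* For [x] in [K] this reads [G x = x], thanks to [x / 0 = 0]. *)
Lemma GfunE r x : (0 < r < k)%N -> let y := reltrace x in
  Gfun k r x = y * (x / y) ^+ (2 ^ (k - r)) + x ^+ (2 ^ k).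
Proof.
move=> /andP[r_gt0 rk] y; rewrite /Gfun; set q := (2 ^ k)%N; set c := (2 ^ (k - r))%N.
have q0 : (0 < q)%N by rewrite expn_gt0.
have r0 : (0 < 2 ^ r)%N by rewrite expn_gt0.
have [y0 | nzy] := eqVneq y 0.
  have hx : x ^+ q = x by apply: subKE; rewrite -reltrace_eq0; apply/eqP.
  have hpow e : x ^+ (e * (q - 1) + 1) = x.
    elim: e => [|e IH]; first by rewrite mul0n expr1.
    by rewrite mulSn -addnA exprD IH -exprSr subn1 prednK.
  rewrite (eq_bigr (fun=> x)) => [|i _]; last exact: hpow.
  (* All terms equal [x], and their number [2 ^ r - 1] is odd. *)
  rewrite sumr_const_nat y0 mul0r add0r hx -mulr_natr.
  by rewrite (natr_odd char2) oddB // oddX eqn0Ngt r_gt0 mulr1.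
have nzx : x != 0.
  by apply: contraNneq nzy => x0; rewrite /y /reltrace x0 frob0 addr0.
have nzxq : x ^+ q != 0 by rewrite expf_neq0.
(* [Y] is the ratio of the progression: the [i]-th term of [G x] is [x ^+ q * Y ^+ i]. Since
   [c * 2 ^ r = q], the power [Y ^+ (2 ^ r)] collapses to [x / x ^+ q]. *)
pose Y := (x ^+ q / x) ^+ c.
have Y1 : Y + 1 = (y / x) ^+ c.
  by rewrite /Y -[in LHS](expr1n L c) -frobD // -(divff nzx) -mulrDl addrC.
have Yr : Y ^+ (2 ^ r) = x / x ^+ q.
  by rewrite /Y frob_comp subnK ?(ltnW rk) // exprMn exprVn frob_involutive.
have -> : (x / y) ^+ c = (Y + 1)^-1 by rewrite Y1 -exprVn invf_div.
have nzY : Y + 1 != 0 by rewrite Y1 expf_neq0 // mulf_neq0 // invr_neq0.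
rewrite (eq_bigr (fun i => x ^+ q * Y ^+ i)); last first.
  move=> i _; have -> : x ^+ q = (x ^+ q / x) * x by rewrite divfK.
  rewrite /Y; have -> : x ^+ q / x = x ^+ (q - 1).
    by apply: (mulIf nzx); rewrite divfK // -exprSr subn1 prednK.
  by rewrite -!exprM -exprSr -exprD; congr (_ ^+ _); ring.
rewrite -big_distrr /=.
have hS := subrX1 Y (2 ^ r).
(* The sum in [Gfun] starts at 1, so the term [Y ^+ 0 = 1] is split off. *)
rewrite -(big_mkord predT (fun i => Y ^+ i)) big_ltn // expr0 Yr in hS.
rewrite !(GRing.subr_pchar2 char2) in hS.
set S := \sum_(1 <= i < 2 ^ r) Y ^+ i in hS *.
apply: (mulIf nzY); rewrite mulrDl divfK //.
have -> : x ^+ q * S * (Y + 1) = x ^+ q * ((Y + 1) * (1 + S)) - x ^+ q * (Y + 1) by ring.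
by rewrite -hS (oppr_pchar2 char2) mulrDr mulr1 mulrCA mulfV // mulr1.
Qed.

Lemma GfunD r x s : (0 < r < k)%N -> subK k s -> let y := reltrace x in
  Gfun k r (x + s) = Gfun k r x + (y * (s / y) ^+ (2 ^ (k - r)) + s).
Proof.
move=> hr hs y; rewrite !GfunE // reltrace_addK // -/y; clearbody y.
by rewrite mulrDl !frobD // (subKE hs) mulrDr addrACA.
Qed.

(** Conjugation replaces [x] by [x + y] in the closed form: the twisted term gains [y], and so does
    the last one, so the changes cancel. *)
Lemma subK_Gfun r x : (0 < r < k)%N -> subK k (Gfun k r x).
Proof.
move=> hr; rewrite GfunE //; set y := reltrace x.
have [y0 | nzy] := eqVneq y 0.
  by rewrite y0 mul0r add0r subKX // -reltrace_eq0; apply/eqP.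
have hy : subK k y := subK_reltrace x.
rewrite /subK frobD // frob_involutive exprMn (subKE hy) exprAC exprMn exprVn (subKE hy).
have -> : x ^+ (2 ^ k) = y + x by rewrite /y /reltrace addrAC (addrr_pchar2 char2) add0r.
clearbody y; rewrite mulrDl divff // frobD // expr1n mulrDr mulr1.
by rewrite addrA [X in X + x == _]addrC.
Qed.

(** * Walsh sums of [G] plus a function constant on the cosets of [K] *)

Section Bent.
Variables (r : nat) (hr : (0 < r < k)%N) (hcop : coprime r k).

Lemma subK_ratio_inj x y : subK k x -> subK k y ->
  x ^+ (2 ^ r) / x = y ^+ (2 ^ r) / y -> x = y.
Proof.
have [r0 _] := andP hr.
have nz (z : L) : z != 0 -> z ^+ (2 ^ r) / z != 0.
  by move=> h; rewrite mulf_neq0 ?invr_neq0 ?expf_neq0.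
move=> hx hy; have [-> | nzx] := eqVneq x 0.
  by rewrite invr0 mulr0; have [-> // | /nz] := eqVneq y 0 => /eqP h /esym.
have [-> | nzy] := eqVneq y 0.
  by rewrite invr0 mulr0 => /eqP; rewrite (negPf (nz x nzx)).
move=> h; pose w := x / y.
have wr : subK r w.
  rewrite /subK /w exprMn exprVn; apply/eqP.
  have nyr : y ^+ (2 ^ r) != 0 by rewrite expf_neq0.
  apply: (mulIf nyr); rewrite divfK // mulrAC -mulrA [_ / y]mulrC.
  by rewrite [y^-1 * _]mulrC -h mulrCA divff // mulr1.
have wk : subK k w by rewrite subKM ?subKV.
have nzw : w != 0 by rewrite mulf_neq0 ?invr_neq0.
have w2 : w ^+ 2 = w.
  (* Bezout gives [km * r = kn * k + 1]. As [w] is fixed by the Frobenius powers [2 ^ r] and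
     [2 ^ k], it is then fixed by squaring. *)
  case: (egcdnP k r0) => km kn e _.
  have := subK_iter km wr; rewrite mulnC e (eqP hcop) mulnC expnD exprM.
  by rewrite subK_iter.
have w1 : w = 1 by apply: (mulfI nzw); rewrite mulr1 -expr2.
by rewrite -[x](divfK nzy) -/w w1 mul1r.
Qed.

Lemma subK_ratio_onto c : subK k c -> exists2 y, subK k y & y ^+ (2 ^ r) / y = c.
Proof.
move=> hc; pose K := [set x : L | subK k x]; pose f y := y ^+ (2 ^ r) / y.
have : f @: K == K.
  rewrite eqEcard card_in_imset ?leqnn ?andbT; last first.
    by move=> x y; rewrite !inE; apply: subK_ratio_inj.
  apply/subsetP => z /imsetP[y + ->]; rewrite inE => hy.
  by rewrite inE subKM ?subKV ?subKX.
move/eqP/setP/(_ c); rewrite inE hc => /imsetP[y]; rewrite inE => hy ->.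
by exists y.
Qed.

Variables (P : L -> L) (hPK : forall x, subK k (P x))
  (hPD : forall x s, subK k s -> P (x + s) = P x).

Definition shift_coef lam a y :=
  lam ^+ (2 ^ r) * (y ^+ (2 ^ r) / y) + lam + reltrace a.

Lemma subK_shift_coef lam a y : subK k lam -> subK k y -> subK k (shift_coef lam a y).
Proof.
move=> hl hy; rewrite subKD ?subK_reltrace // subKD //.
by rewrite subKM ?subKX // subKM ?subKV ?subKX.
Qed.

Definition walsh_term lam a x :=
  sgn (trace k (lam * (Gfun k r x + P x)) + trace k.*2 (a * x)).

Lemma walsh_term_shift lam a x s : subK k lam -> subK k s ->
  walsh_term lam a (x + s) =
    walsh_term lam a x * sgn (trace k (shift_coef lam a (reltrace x) * s)).
Proof.
move=> hl hs; rewrite /walsh_term hPD // GfunD // -/(reltrace x).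
have hy : subK k (reltrace x) := subK_reltrace x.
have hH : subK k (Gfun k r x + P x) by rewrite subKD ?subK_Gfun.
have hB := subK_shift_coef a hl hy.
rewrite -(sgnD char2) ?(trace_bit char2) ?subKM //; last first.
  by rewrite subKD // (trace_bit char2) ?subKM ?subK_full.
congr (sgn _); rewrite addrAC mulrDr traceD //.
rewrite [in trace _ (a * _)]mulrDr [in LHS](traceD char2 k.*2).
rewrite addrACA; congr (_ + _).
move: (reltrace x) hy {hB} => y hy.
rewrite trace_double {1}/reltrace [(a * s) ^+ _]exprMn (subKE hs) -mulrDl.
rewrite -/(reltrace a) -(traceD char2).
rewrite [in RHS]/shift_coef !mulrDl mulrDr !(traceD char2 k); congr (_ + _ + _).
have [_ /ltnW rk] := andP hr.
(* Applying the Frobenius power [2 ^ r] inside the trace turns the exponent [2 ^ (k - r)] on [s / y]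
   into [2 ^ k], which is trivial on [K]; the expression becomes linear in [s]. *)
rewrite -(trace_frob r) ?subKM ?subKX ?subKM ?subKV //.
rewrite !exprMn !frob_comp subnK // exprVn (subKE hs) (subKE hy).
by congr (trace k _); ring.
Qed.

Lemma sum_subK_const (z : int) : \sum_(s : L | subK k s) z = (2 ^ k)%:Z * z.
Proof.
rewrite sumr_const -[LHS]mulr_natl -natz; congr (_%:R * _).
by rewrite -[RHS]card_subK.
Qed.

Lemma walsh_sum_norm lam a : subK k lam -> lam != 0 ->
  `| \sum_x walsh_term lam a x | = (2 ^ k)%:Z.
Proof.
move=> hl nzl; set S := \sum_x _.
have nzq : (2 ^ k)%:Z != 0 by rewrite eqz_nat expn_eq0.
have hB x : subK k (shift_coef lam a (reltrace x)).
  by apply: subK_shift_coef => //; apply: subK_reltrace.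
have hS : S = \sum_(x | shift_coef lam a (reltrace x) == 0) walsh_term lam a x.
  (* Averaging over translates by [K]: [2 ^ k] times the sum is a double sum whose inner sum over
     [s] is a character sum, zero unless the shift coefficient vanishes. *)
  apply: (mulfI nzq).
  have -> : (2 ^ k)%:Z * S = \sum_(s | subK k s) \sum_x walsh_term lam a (x + s).
    rewrite (eq_bigr (fun=> S)) => [|s _]; last by rewrite /S [RHS](reindex_inj (addIr s)).
    by rewrite sum_subK_const.
  rewrite exchange_big /= [in RHS]big_mkcond mulr_sumr; apply: eq_bigr => x _.
  rewrite (eq_bigr _ (fun s hs => walsh_term_shift a x hl hs)) -mulr_sumr.
  rewrite (sum_sgn_trace char2 k_gt0 card_subK (hB x)).
  by case: eqP; rewrite ?muln0 ?mulr0 // muln1 mulrC.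
(* The value that [y ^+ (2 ^ r) / y] must take for [shift_coef lam a y] to vanish. *)
pose c := (lam + reltrace a) / lam ^+ (2 ^ r).
have [|y hy yc] := @subK_ratio_onto c.
  by rewrite subKM ?subKV ?subKX // subKD ?subK_reltrace.
have [x0 hx0] := reltrace_onto hy.
have B0 z : subK k z -> (shift_coef lam a z == 0) = (z == y).
  move=> hz; rewrite /shift_coef -addrA addr_eq0 (oppr_pchar2 char2).
  have nzlr : lam ^+ (2 ^ r) != 0 by rewrite expf_neq0.
  rewrite -(divfK nzlr (lam + _)) -/c mulrC (inj_eq (mulIf nzlr)) -yc.
  by apply/eqP/eqP => [/subK_ratio_inj-> // | ->].
rewrite hS (reindex_inj (addrI x0)) /=.
rewrite (eq_bigl (subK k)) => [|s]; last first.
  by rewrite B0 ?subK_reltrace // reltraceD hx0 -reltrace_eq0 -{2}[y]addr0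
    (inj_eq (addrI y)).
rewrite (eq_bigr (fun=> walsh_term lam a x0)) => [|s hs]; last first.
  have /eqP b0 : shift_coef lam a (reltrace x0) == 0.
    by rewrite B0 ?subK_reltrace // hx0.
  by rewrite walsh_term_shift // b0 mul0r trace0 sgn0 mulr1.
by rewrite sum_subK_const normrM /walsh_term sgnE normrX normrN1 expr1n mulr1.
Qed.

(** Keeping [P] abstract covers [H], and also [G] itself with [P] zero, as the degree bound
    requires. *)
Lemma vbent_Gfun_add : vbent k.*2 k (fun x => Gfun k r x + P x).
Proof.
split=> [x | lam hl nzl a]; first by rewrite subKD ?subK_Gfun.
by rewrite doubleK -(walsh_sum_norm a hl nzl).
Qed.

End Bent.

(** * Derivatives along basis vectors, characters of [L], and Rothaus' bound *)

Section Degree.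
Variables (e : 'I_k.*2 -> L) (he : f2indep e).
Implicit Types I J : {set 'I_k.*2}.

Definition subset_sum J := \sum_(j in J) e j.
(** In characteristic 2 this is the iterated derivative of [g] at 0 in the directions [e i], [i] in
    [I]; for a Boolean [g] it is the ANF coefficient at [I]. *)
Definition derivative (g : L -> L) I := \sum_(J in powerset I) g (subset_sum J).
Definition character x := sgn (trace k.*2 x).

Lemma bit_trace_full x : subK 1 (trace k.*2 x).
Proof. by rewrite trace_bit // subK_full. Qed.

Lemma characterD x y : character (x + y) = character x * character y.
Proof. by rewrite /character traceD // sgnD // bit_trace_full. Qed.

Lemma character_subset_sum I a :
  character (a * subset_sum I) = \prod_(j in I) character (a * e j).
Proof.
rewrite /subset_sum mulr_sumr; apply: (big_morph character characterD).
by rewrite /character trace0 sgn0.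
Qed.

Definition orthogonal I :=
  [pred a : L | [forall i in I, trace k.*2 (a * e i) == 0]].

(** The sum factors as the product of [character (a * e i) + 1] over [I], each factor being 2 or
    0. *)
Lemma sum_character_powerset I a :
  \sum_(J in powerset I) character (a * subset_sum J) = (2 ^ #|I| * orthogonal I a)%:Z.
Proof.
(* Zero outside [I], so that expanding the product over all indices kills the subsets not contained
   in [I]. *)
pose F i := if i \in I then character (a * e i) else 0.
have -> : \sum_(J in powerset I) character (a * subset_sum J) = \prod_i (F i + 1).
  rewrite bigA_distr big_mkcond /=; apply: eq_bigr => J _.
  rewrite inE character_subset_sum -big_mkcond /=.
  case: ifP => [/subsetP sJ | /negbT/subsetPn[j jJ jI]].
    by apply: eq_bigr => j /sJ jI; rewrite /F jI.
  by rewrite (bigD1 j) //= /F (negPf jI) mul0r.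
have -> : \prod_i (F i + 1) = \prod_(i in I) (character (a * e i) + 1).
  by rewrite [RHS]big_mkcond; apply: eq_bigr => i _; rewrite /F; case: ifP; rewrite ?add0r.
have [/forall_inP h | /forall_inPn[i iI hi]] := boolP (orthogonal I a).
  rewrite (eq_bigr (fun=> 2)) => [|i /h]; first by rewrite prodr_const muln1 -natz natrX.
  by rewrite /character => /eqP->; rewrite sgn0.
by rewrite muln0 (bigD1 i) //= /character {1}/sgn (negPf hi) addNr mul0r.
Qed.

Lemma sum_character_full b : \sum_a character (b * a) = (2 ^ k.*2 * (b == 0))%:Z.
Proof.
rewrite -(sum_sgn_trace char2 _ card_subK_full (subK_full b)) ?double_gt0 //.
by apply: eq_bigl => s; rewrite subK_full.
Qed.

Lemma subset_sum_eq0 J : (subset_sum J == 0) = (J == set0).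
Proof.
apply/eqP/eqP => [h | ->]; last by rewrite /subset_sum big_set0.
apply/setP => i; rewrite inE; apply/negbTE.
exact: (he (b := fun i => i \in J)).
Qed.

(** Double counting of a character sum over [a] and [J]: summing over [a] first, only [J = set0]
    survives, by independence of [e]. *)
Lemma card_orthogonal I : (2 ^ #|I| * #|orthogonal I| = 2 ^ k.*2)%N.
Proof.
have : \sum_a \sum_(J in powerset I) character (a * subset_sum J) = (2 ^ k.*2)%:Z.
  rewrite exchange_big (bigD1 set0) /=; last by rewrite inE sub0set.
  rewrite [X in _ + X]big1 => [|J /andP[_ J0]]; last first.
    under eq_bigr do rewrite mulrC.
    by rewrite sum_character_full subset_sum_eq0 (negPf J0) muln0.
  under eq_bigr do rewrite mulrC.
  by rewrite sum_character_full subset_sum_eq0 eqxx muln1 addr0.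
under eq_bigr do rewrite sum_character_powerset PoszM.
rewrite -mulr_sumr => h; apply/eqP; rewrite -eqz_nat PoszM -h; apply/eqP.
congr (_ * _); rewrite -sum1_card big_mkcond /= -natz natr_sum.
by apply: eq_bigr => a _; rewrite natz inE; case: [forall _ in _, _].
Qed.

(* Poisson summation over the span of the [e i], [i] in [I], gives the weight of
   [g] there modulo 2. *)
Lemma bent_derivative0 (g : L -> L) I : (1 < k)%N -> (forall x, subK 1 (g x)) ->
  bent k.*2 g -> (k < #|I|)%N -> derivative g I = 0.
Proof.
move=> k_gt1 hg hb hI; pose W a := \sum_x sgn (g x + trace k.*2 (a * x)).
pose wt := #|[set J in powerset I | g (subset_sum J) != 0]|.
have -> : derivative g I = wt%:R.
  rewrite /derivative /wt -sum1_card natr_sum big_mkcond [RHS]big_mkcond /=.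
  apply: eq_bigr => J _; rewrite !inE; case: ifP => //= _.
  by rewrite {1}(bitP (hg (subset_sum J))); case: (g (subset_sum J) != 0).
have hwt : \sum_(J in powerset I) sgn (g (subset_sum J)) = (2 ^ #|I|)%:Z - wt%:Z *+ 2.
  rewrite -card_powerset /wt -!sum1_card -!natz !natr_sum.
  rewrite [X in _ - X *+ 2]big_mkcond [\sum_(J in powerset I) _ in LHS]big_mkcond.
  rewrite [X in X - _]big_mkcond /= -sumrMnl -sumrB.
  by apply: eq_bigr => J _; rewrite !inE /sgn; case: ifP => //= _; case: eqP.
(* Fourier inversion; summed over the subset sums of [I] it gives the Poisson formula [hsum]. *)
have hinv p : \sum_a W a * character (p * a) = (2 ^ k.*2)%:Z * sgn (g p).
  transitivity (\sum_x sgn (g x) * \sum_a character ((x + p) * a)).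
    under eq_bigr do rewrite mulr_suml.
    rewrite exchange_big; apply: eq_bigr => x _; rewrite mulr_sumr.
    apply: eq_bigr => a _; rewrite mulrDl characterD [a * x]mulrC mulrA.
    by rewrite sgnD ?bit_trace_full.
  under eq_bigr do rewrite sum_character_full addr_eq0 (oppr_pchar2 char2).
  rewrite (bigD1 p) //= eqxx muln1 mulrC big1 ?addr0 // => x /negPf->.
  by rewrite muln0 mulr0.
have hsum : (2 ^ k.*2)%:Z * ((2 ^ #|I|)%:Z - wt%:Z *+ 2)
    = (2 ^ #|I|)%:Z * \sum_(a | orthogonal I a) W a.
  rewrite -hwt mulr_sumr; under eq_bigr do rewrite -hinv.
  rewrite exchange_big /= mulr_sumr [RHS]big_mkcond; apply: eq_bigr => a _.
  rewrite -mulr_sumr; under eq_bigr do rewrite mulrC.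
  rewrite sum_character_powerset mulrC PoszM /=.
  by case: [forall _ in _, _]; rewrite ?mulr1 // mulr0 mul0r.
(* By bentness each [W a] is [2 ^ k] up to sign, so its sum depends only on the number [T] of
   negative values. *)
pose T := #|[pred a in orthogonal I | W a < 0]|.
have hW : \sum_(a | orthogonal I a) W a = (2 ^ k)%:Z * (#|orthogonal I|%:Z - T%:Z *+ 2).
  rewrite /T -!sum1_card -!natz !natr_sum.
  rewrite [X in _ - X *+ 2]big_mkcond [X in X - _]big_mkcond.
  rewrite -sumrMnl -sumrB mulr_sumr [LHS]big_mkcond /=; apply: eq_bigr => a _; rewrite !inE natz.
  case: ifP => /= _; last by rewrite mul0rn subrr mulr0.
  have := hb a; rewrite doubleK -/(W a).
  by case: ltrP => [/ltr0_norm-> | /ger0_norm->] h; lia.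
have eI : #|I| = ((#|I| - k.+1).+1 + k)%N by lia.
set d := (#|I| - k.+1)%N in eI.
have ek : k = (k - 2).+2 by lia.
set c := (k - 2)%N in ek.
have hP : (2 ^ d.+1 * #|orthogonal I| = 2 ^ k)%N.
  apply/eqP; rewrite -(eqn_pmul2l (m := 2 ^ k)) ?expn_gt0 // -expnD addnn.
  by rewrite -(card_orthogonal I) mulnA -expnD [in X in _ == X]eI addnC.
suff /negbTE ow : ~~ odd wt by rewrite (natr_odd char2) ow.
(* Every term but [wt%:Z *+ 2] is divisible by 4, since [k >= 2]; hence [wt] is even. *)
have : (2 ^ #|I|)%:Z - wt%:Z *+ 2 = (2 ^ k)%:Z - (2 ^ d.+1 * T)%:Z *+ 2.
  have nz : (2 ^ k.*2)%:Z != 0 by rewrite eqz_nat expn_eq0.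
  apply: (mulfI nz); rewrite hsum hW eI -addnn !expnD !PoszM.
  have -> : (2 ^ k)%:Z = (2 ^ d.+1)%:Z * #|orthogonal I|%:Z by rewrite -PoszM hP.
  by ring.
have -> : (2 ^ #|I| = 4 * 2 ^ (d.+1 + c))%N by rewrite eI ek !addnS !expnS; lia.
by rewrite ek !expnS; lia.
Qed.

(** A nonzero derivative [D] could be scaled by some [lam] in [K] to have [trace k (lam * D) != 0],
    against the Boolean case for the component at [lam]. *)
Lemma vbent_derivative0 (H : L -> L) I : (1 < k)%N -> vbent k.*2 k H ->
  (k < #|I|)%N -> derivative H I = 0.
Proof.
move=> k_gt1 [hK hb] hI; apply/eqP; apply: contraT => nz.
have hD : subK k (derivative H I) by apply: (subK_sum char2) => J _; apply: hK.
have [s hs] := trace_neq0 k_gt0 card_subK.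
have hl : subK k (s / derivative H I) by rewrite subKM ?subKV.
have [-> | nzs] := eqVneq s 0; first by rewrite trace0 eqxx.
have <- : s / derivative H I * derivative H I = s by rewrite divfK.
rewrite {2}/derivative mulr_sumr trace_sum //.
rewrite -/(derivative (fun x => trace k (s / derivative H I * H x)) I).
rewrite bent_derivative0 ?eqxx // => [x|].
  by apply: (trace_bit char2); apply: subKM; [apply: hl | apply: hK].
by apply: hb; rewrite ?mulf_neq0 ?invr_neq0.
Qed.

(** * Coordinates in a basis of [K], and [vec_deg] read off from derivatives *)

Variables (w : 'I_k -> L) (hwK : forall j, subK k (w j)) (hw : f2indep w).
Implicit Types b : {ffun 'I_k -> bool}.

Definition bool_comb b := \sum_(i < k) (b i)%:R * w i.

Lemma bool_comb_addb b (c : {ffun 'I_k -> bool}) :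
  bool_comb b + bool_comb c = \sum_(i < k | b i (+) c i) w i.
Proof.
rewrite -big_split [RHS]big_mkcond /=; apply: eq_bigr => i _.
by rewrite -mulrDl -addbR //; case: (_ (+) _); rewrite ?mul1r ?mul0r.
Qed.

Lemma bool_comb_inj : injective bool_comb.
Proof.
move=> b c hbc; apply/ffunP => i; apply/eqP; rewrite -negb_add.
have := bool_comb_addb b c; rewrite hbc (addrr_pchar2 char2 (bool_comb c)) => /esym h.
by have := hw h i; case: (b i); case: (c i).
Qed.

Lemma coords_bool_comb b : coords w (bool_comb b) = b.
Proof.
rewrite /coords; case: pickP => [c /eqP /bool_comb_inj -> // | /(_ b)].
by rewrite eqxx.
Qed.

(** Counting: the [2 ^ k] combinations are distinct elements of [K], so they exhaust it. *)
Lemma subK_bool_comb y : subK k y -> exists b, y = bool_comb b.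
Proof.
move=> hy; have : bool_comb @: [set: {ffun 'I_k -> bool}] == [set x | subK k x].
  rewrite eqEcard card_imset; last exact: bool_comb_inj.
  rewrite cardsT card_ffun card_bool card_ord -card_subK; apply/andP; split.
    apply/subsetP => x /imsetP[b _ ->]; rewrite inE subK_sum // => i _.
    by case: (b i); rewrite ?mul1r ?mul0r ?subK_0.
  by rewrite subset_leq_card //; apply/subsetP => x; rewrite !inE.
by move/eqP/setP/(_ y); rewrite inE hy => /imsetP[b _ ->]; exists b.
Qed.

Lemma anf_coef_coords (H : L -> L) I j : (forall x, subK k (H x)) ->
  anf_coef e (fun x => coords w (H x) j) I = coords w (derivative H I) j.
Proof.
move=> hK; pose c := [ffun i => anf_coef e (fun x => coords w (H x) i) I].
suff -> : derivative H I = bool_comb c by rewrite coords_bool_comb ffunE.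
have E x : H x = bool_comb (coords w (H x)).
  by have [b ->] := subK_bool_comb (hK x); rewrite coords_bool_comb.
rewrite /derivative (eq_bigr _ (fun J _ => E (subset_sum J))) exchange_big /=.
apply: eq_bigr => i _; rewrite -mulr_suml ffunE /anf_coef -natr_odd //.
congr (_ * _); rewrite -sum1_card natr_sum big_mkcond [RHS]big_mkcond /=.
by apply: eq_bigr => J _; rewrite !inE; case: ifP => //= _; case: (coords w _ i).
Qed.

Lemma vec_deg_le (H : L -> L) m : (forall x, subK k (H x)) ->
  (forall I, (m < #|I|)%N -> derivative H I = 0) -> (vec_deg e w H <= m)%N.
Proof.
move=> hK h; apply/bigmax_leqP => j _; apply/bigmax_leqP => I.
rewrite anf_coef_coords // leqNgt; apply: contraL => /h ->.
have -> : 0 = bool_comb [ffun=> false].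
  by rewrite /bool_comb big1 // => i _; rewrite ffunE mul0r.
by rewrite coords_bool_comb ffunE.
Qed.

Lemma vec_deg_ge (H : L -> L) I : (forall x, subK k (H x)) ->
  derivative H I != 0 -> (#|I| <= vec_deg e w H)%N.
Proof.
move=> hK nz; have hD : subK k (derivative H I).
  by apply: (subK_sum char2) => J _; apply: hK.
have [b hb] := subK_bool_comb hD.
have [j bj] : exists j, b j.
  apply/existsP; apply: contraR nz => /existsPn h; rewrite hb /bool_comb big1 // => i _.
  by rewrite (negPf (h i)) mul0r.
apply: leq_trans (leq_bigmax j); apply: (leq_bigmax_cond (P := anf_coef e _)).
by rewrite anf_coef_coords // hb coords_bool_comb.
Qed.

(** Moves linear relations between bits of [L] to ['F_2], where matrix rank is available; both sides
    test the parity of the number of nonzero terms. *)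
Lemma sum_bit_F2 (T : finType) (P : pred T) (t : T -> L) : (forall i, subK 1 (t i)) ->
  (\sum_(i | P i) (t i != 0)%:R == 0 :> 'F_2) = (\sum_(i | P i) t i == 0).
Proof.
move=> ht; rewrite (eq_bigr (fun i => (t i != 0)%:R) (fun i _ => bitP (ht i))).
by rewrite -!natr_sum -(GRing.dvdn_pcharf char2) -(GRing.dvdn_pcharf (pchar_Fp _)).
Qed.

Lemma F2_neq0 (c : 'F_2) : c = (c != 0)%:R.
Proof. by apply: val_inj; case: c => [[|[|]]]. Qed.

(** The monomial of [Q] equals 1 at the [2 ^ (k - #|Q|)] sets containing [Q], an odd number only for
    [Q = setT]. *)
Lemma sum_eval_red (a : {ffun {set 'I_k} -> bool}) :
  \sum_(X : {set 'I_k}) eval_red a (fun i => (i \in X)%:R) = (a setT)%:R :> L.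
Proof.
rewrite exchange_big /= big_mkcond (bigD1 setT) //=.
have count (Q : {set 'I_k}) :
    \sum_(X : {set 'I_k}) \prod_(i in Q) (i \in X)%:R = (Q == setT)%:R :> L.
  transitivity (\sum_(X in powerset (~: Q)) 1 : L).
    rewrite (reindex_inj (@setC_inj _)) [RHS]big_mkcond; apply: eq_bigr => X _ /=.
    rewrite inE -setCS !setCK; case: ifP => [/subsetP sQ | /negbT/subsetPn[i iQ iX]].
      by rewrite big1 // => i /sQ; rewrite inE => ->.
    by rewrite (bigD1 i) //= inE in iX *; rewrite (negPf iX) mul0r.
  rewrite sumr_const card_powerset [in LHS](natr_odd char2) oddX orbF cards_eq0.
  by rewrite -(inj_eq (@setC_inj _)) setCK setC0.
rewrite count eqxx big1 ?addr0 => [|Q /negPf hQ]; first by case: (a _).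
by rewrite count hQ; case: (a _).
Qed.

(** * Choice of [k] basis vectors on which [k] trace functionals are independent *)

Variables (v : 'I_k -> L) (hv : f2indep v).

Definition trace_matrix : 'M['F_2]_(k, k.*2) :=
  \matrix_(i, j) (trace k.*2 (v i * e j) != 0)%:R.

(** A relation between rows gives a sum [z] of some [v i] that is trace-orthogonal to the whole
    basis [e]. By [card_orthogonal] only 0 is, and [v] is independent. *)
Lemma trace_matrix_row_free : row_free trace_matrix.
Proof.
apply: inj_row_free => c hc.
pose z := \sum_(i < k | c 0 i != 0) v i.
have hz j : trace k.*2 (z * e j) = 0.
  apply/eqP; rewrite mulr_suml trace_sum // -sum_bit_F2 => [|i]; last exact: bit_trace_full.
  have /rowP/(_ j) := hc; rewrite !mxE => h; apply/eqP; rewrite -[RHS]h big_mkcond.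
  apply: eq_bigr => i _; rewrite mxE [in RHS](F2_neq0 (c 0 i)).
  by case: (c 0 i != 0); rewrite ?mul1r ?mul0r.
have o1 : (#|orthogonal setT| <= 1)%N.
  have := card_orthogonal setT; rewrite cardsT card_ord -[RHS]muln1 => /eqP.
  by rewrite eqn_pmul2l ?expn_gt0 // => /eqP->.
have z0 : z = 0.
  by apply: (card_le1_eqP o1); rewrite inE; apply/forall_inP => i _; rewrite ?hz ?mul0r ?trace0.
apply/rowP => i; rewrite mxE; apply/eqP; rewrite -[_ == _]negbK.
exact: (hv (b := fun i => c 0 i != 0)).
Qed.

(** A matrix of rank [k] has [k] independent columns; the indicator vector of [S] is killed by that
    invertible minor. *)
Lemma exists_separating_indices : exists2 f : 'I_k -> 'I_k.*2, injective f &
  forall S : {set 'I_k}, (forall i, trace k.*2 (v i * \sum_(s in S) e (f s)) = 0) ->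
  S = set0.
Proof.
have fullM : row_full trace_matrix^T.
  by rewrite /row_full mxrank_tr; apply: trace_matrix_row_free.
exists (fullrankfun fullM) => [|S hS]; first exact: fullrankfun_inj.
have := fullrowsub_free fullM; set f := fullrankfun fullM in hS * => /row_free_inj inj.
pose c : 'rV['F_2]_k := \row_s (s \in S)%:R.
have c0 : c = 0.
  apply: (inj 1%N); rewrite mul0mx; apply/rowP => i; rewrite !mxE.
  have /eqP := hS i; rewrite mulr_sumr trace_sum // -sum_bit_F2 => [/eqP h|s];
    last exact: bit_trace_full.
  rewrite -[RHS]h [RHS]big_mkcond; apply: eq_bigr => s _; rewrite !mxE.
  by case: (s \in S); rewrite ?mul1r ?mul0r.
apply/setP => s; rewrite inE; have /rowP/(_ s) := c0; rewrite !mxE.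
by case: (s \in S).
Qed.

Lemma derivative_eval_red (a : {ffun {set 'I_k} -> bool}) :
  exists2 I : {set 'I_k.*2}, #|I| = k &
  derivative (fun x => eval_red a (fun i => trace k.*2 (v i * x))) I = (a setT)%:R.
Proof.
have [f f_inj hf] := exists_separating_indices.
have imset_sum (S : {set 'I_k}) : subset_sum (f @: S) = \sum_(s in S) e (f s).
  by rewrite /subset_sum big_imset //; apply: in2W.
exists (f @: setT); first by rewrite card_imset // cardsT card_ord.
(* [Phi] sends a subset of the chosen directions to the cube point where the polynomial is
   evaluated. Separation, applied to a symmetric difference, makes it injective, hence a permutation
   of the cube. *)
pose Phi (S : {set 'I_k}) := [set i | trace k.*2 (v i * subset_sum (f @: S)) != 0].
have Phi_inj : injective Phi.
  move=> S S' /setP hSS; pose U := [set s | (s \in S) (+) (s \in S')].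
  have U0 : U = set0.
    apply: hf => i; have := hSS i; rewrite !inE !imset_sum.
    set t := trace _ _; set t' := trace _ _ => htt.
    have -> : \sum_(s in U) e (f s) = \sum_(s in S) e (f s) + \sum_(s in S') e (f s).
      rewrite big_mkcond [X in _ = X + _]big_mkcond [X in _ = _ + X]big_mkcond -big_split.
      apply: eq_bigr => s _; rewrite inE /=.
      by case: (s \in S); case: (s \in S'); rewrite ?addr0 ?add0r //= addrr_pchar2.
    rewrite mulrDr traceD // -/t -/t'.
    have -> : t = t' by rewrite (bitP (bit_trace_full _ : subK 1 t)) htt -bitP ?bit_trace_full.
    by rewrite addrr_pchar2.
  apply/setP => s; apply/eqP; rewrite -negb_add.
  by have /setP/(_ s) := U0; rewrite !inE => ->.
rewrite -sum_eval_red (reindex_inj Phi_inj) /=.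
rewrite /derivative (reindex_onto (fun S : {set 'I_k} => f @: S)
  (fun J : {set 'I_k.*2} => f @^-1: J)) /= => [|J]; last first.
  rewrite inE => /subsetP sJ; apply/setP => j; apply/imsetP/idP => [[i] | jJ].
    by rewrite inE => hi ->.
  by have /imsetP[i _ ji] := sJ j jJ; exists i; rewrite // inE -ji.
apply: eq_big => [S | S _].
  rewrite inE imsetS ?subsetT //=; apply/eqP/setP => s.
  by rewrite inE mem_imset.
apply: eq_bigr => Q _; apply: eq_bigr => i _.
by rewrite inE -bitP // bit_trace_full.
Qed.

End Degree.
End QuadraticExtension.

(** * Application to [Hfun] *)

Theorem theorem6 (k r t n : nat) (L : finFieldType)
  (hn : n = k.*2) (hL : #|L| = (2 ^ n)%N)
  (ht1 : (1 <= t)%N) (htk : (t <= k)%N)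
  (hr1 : (1 < r)%N) (hrk : (r < k)%N) (hcop : coprime r k)
  (u : 'I_k -> L) (hu : forall i, subK k (u i)) (hub : f2indep u)
  (a : {ffun {set 'I_t} -> bool})
  (idx : 'I_t -> 'I_k) (hidx : injective idx) :
  vbent n k (Hfun n r u a idx) /\
  (forall (e : 'I_n -> L) (w : 'I_k -> L),
      f2indep e -> (forall j, subK k (w j)) -> f2indep w ->
      deg_red a = k -> vec_deg e w (@Gfun L k r) <> k ->
      vec_deg e w (Hfun n r u a idx) = k).
Proof.
subst n; have k_gt1 : (1 < k)%N by apply: ltn_trans hrk.
have k_gt0 := ltnW k_gt1; have char2 := card_finPcharP hL isT.
have hr : (0 < r < k)%N by rewrite (ltnW hr1).
pose P x := eval_red a (fun j => trace k.*2 (u (idx j) * x)).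
have P_bit x : subK k (P x).
  apply: (subK_sum char2) => I _; apply: subK_prod => j _; apply: subK_bit.
  exact: bit_trace_full.
have PD x s : subK k s -> P (x + s) = P x.
  move=> hs; apply: eq_bigr => I _; apply: eq_bigr => j _.
  rewrite mulrDr (traceD char2) [X in _ + X](trace_double hL).
  by rewrite /reltrace (subKE (subKM (hu _) hs)) (addrr_pchar2 char2) trace0 addr0.
have H_bent : vbent k.*2 k (Hfun k.*2 r u a idx).
  exact: (vbent_Gfun_add k_gt0 hL hr hcop P_bit PD).
split=> // e w he hwK hw ha hG.
(* A reduced polynomial in [t] variables has degree at most [t], so degree [k] forces [t = k], and
   the monomial reaching it is the full product. *)
have et : t = k.
  apply/eqP; rewrite eqn_leq htk -{1}ha; apply/bigmax_leqP => I _.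
  by rewrite -[t in (_ <= t)%N]card_ord max_card.
subst t.
have aT : a setT.
  have [|I aI] := eq_bigmax_cond (A := [pred I | a I]) (fun I : {set 'I_k} => #|I|).
    rewrite lt0n; apply: contraTneq k_gt0 => /eqP/pred0P a0.
    by rewrite -[k]ha /deg_red big_pred0.
  rewrite -/(deg_red a) ha => cI; suff <- : I = setT by [].
  by apply/eqP; rewrite eqEcard subsetT cardsT card_ord [X in (X <= _)%N]cI /=.
have G_K x : subK k (Gfun k r x) := subK_Gfun hL x hr.
have G_le : (vec_deg e w (@Gfun L k r) <= k)%N.
  apply: (vec_deg_le k_gt0 hL hwK hw) => // I hI.
  have := vbent_Gfun_add k_gt0 hL hr hcop (fun=> subK_0 L k) (fun _ _ _ => erefl).
  move/(vbent_derivative0 k_gt0 hL he k_gt1)/(_ hI) => hD; rewrite -[RHS]hD.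
  by apply: eq_bigr => J _; rewrite addr0.
(* With [t = k] the injection [idx] is a permutation, so reindexing keeps [u] independent. *)
have hv : f2indep (fun i => u (idx i)).
  have [g gK Kg] := injF_bij hidx; move=> b hb i.
  rewrite -[i]gK; apply: (hub (b \o g)).
  rewrite (reindex_inj hidx) -[RHS]hb; apply: eq_bigl => j.
  by rewrite /= gK.
have [I cI hI] := derivative_eval_red k_gt0 hL he hv a.
apply/eqP; rewrite eqn_leq (vec_deg_le k_gt0 hL hwK hw) //=; first last.
- by move=> J hJ; apply: (vbent_derivative0 k_gt0 hL he k_gt1).
- by case: H_bent.
rewrite -[X in (X <= _)%N]cI; apply: (vec_deg_ge k_gt0 hL hwK hw); first by case: H_bent.
rewrite /derivative big_split /= [X in _ + X]hI aT.
(* Otherwise [G] would have degree at least [#|I| = k], hence exactly [k] by [G_le]. *)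
have -> : \sum_(J in powerset I) Gfun k r (\sum_(j in J) e j) = 0.
  apply/eqP; apply: contra_notT hG => nz; apply/eqP; rewrite eqn_leq G_le /=.
  by rewrite -[X in (X <= _)%N]cI; apply: (vec_deg_ge k_gt0 hL hwK hw).
by rewrite add0r oner_neq0.
Qed.
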